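(* Let $R=\{(1,0),(1,1),(2,0),(2,1),(2,2),(3,0),(3,1),(3,2)\}$, let $\mathrm{P}_{13}=(123,R)$ and $\mathrm{P}_{14}=(132,R)$ be mesh patterns, and for $n\ge1$ let $$F_n(s,t)=\sum_{\sigma\in\mathfrak{S}_n}s^{\mathrm{P}_{13}(\sigma)}t^{\mathrm{P}_{14}(\sigma)}.$$ Then $F_1(s,t)=1$, $F_2(s,t)=2$, and for $n\ge 3$, $$F_n(s,t)=n(n-2)!+(n-2+s+t)\bigl(F_{n-1}(s,t)-(n-2)!\bigr).$$ Consequently, for every $n\ge1$, $F_n(s,t)$ is a polynomial in $(s+t)$, and for all integers $k,\ell\ge 0$, $$|\{\sigma\in\mathfrak{S}_n: \mathrm{P}_{13}(\sigma)=k,\ \mathrm{P}_{14}(\sigma)=\ell\}| = |\{\sigma\in\mathfrak{S}_n: \mathrm{P}_{14}(\sigma)=k,\ \mathrm{P}_{13}(\sigma)=\ell\}|.$$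
   Context: $\mathfrak{S}_n$ is the set of permutations $\sigma=\sigma_1\sigma_2\cdots\sigma_n$ of $[n]=\{1,\dots,n\}$ in one-line notation. A mesh pattern is a pair $p=(\pi,R)$ with $\pi\in\mathfrak{S}_m$ and $R\subseteq\{0,\dots,m\}\times\{0,\dots,m\}$ (the set of shaded unit cells, each given by its bottom-left corner, in the grid with dots at $(i,\pi_i)$). An occurrence of $p$ in $\sigma\in\mathfrak{S}_n$ is a choice of indices $i_1<\cdots<i_m$ such that $\sigma_{i_1}\cdots\sigma_{i_m}$ is order-isomorphic to $\pi$ and, for every $(a,b)\in R$, there is no index $r$ with $i_a<r<i_{a+1}$ and $v_b<\sigma_r<v_{b+1}$; here $v_1<\cdots<v_m$ is the increasing rearrangement of $\sigma_{i_1},\dots,\sigma_{i_m}$, $i_0=v_0=0$ and $i_{m+1}=v_{m+1}=n+1$. $p(\sigma)$ denotes the number of occurrences of $p$ in $\sigma$. *)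

(* Defs.v *)
From mathcomp Require Import all_boot all_order all_fingroup all_algebra.
From mathcomp.multinomials Require Import mpoly.

Set Implicit Arguments.
Unset Strict Implicit.
Unset Printing Implicit Defensive.

Import GRing.Theory.
Local Open Scope ring_scope.

(* Permutations of [n] are elements of 'S_n, acting on {0, .., n-1}.  Shading and
   occurrences use the 1-based positions and values of [n], hence the successors. *)

Record mesh_pattern (m : nat) := MeshPattern {
  underlying : 'S_m;
  shading : {set 'I_m.+1 * 'I_m.+1}
}.

(* [:: i_0; i_1; ..; i_m; i_(m+1)], with i_0 = 0 and i_(m+1) = n + 1. *)
Definition occ_positions (m n : nat) (i : m.-tuple 'I_n) : seq nat :=
  (0 :: rcons [seq (nat_of_ord x).+1 | x <- i] n.+1)%N.

(* [:: v_0; v_1; ..; v_m; v_(m+1)], with v_0 = 0 and v_(m+1) = n + 1. *)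
Definition occ_values (m n : nat) (s : 'S_n) (i : m.-tuple 'I_n) : seq nat :=
  (0 :: rcons (sort leq [seq (nat_of_ord (s x)).+1 | x <- i]) n.+1)%N.

Definition order_isomorphic (m n : nat) (pi : 'S_m) (s : 'S_n)
    (i : m.-tuple 'I_n) : bool :=
  [forall j : 'I_m, forall k : 'I_m,
    (s (tnth i j) < s (tnth i k))%N == (pi j < pi k)%N].

Definition cell_empty (m n : nat) (s : 'S_n) (i : m.-tuple 'I_n)
    (a b : nat) : bool :=
  [forall r : 'I_n,
    ~~ [&& (nth 0 (occ_positions i) a < r.+1)%N,
           (r.+1 < nth 0 (occ_positions i) a.+1)%N,
           (nth 0 (occ_values s i) b < (s r).+1)%N
         & ((s r).+1 < nth 0 (occ_values s i) b.+1)%N]].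

Definition occurrence (m n : nat) (p : mesh_pattern m) (s : 'S_n)
    (i : m.-tuple 'I_n) : bool :=
  [&& sorted ltn [seq nat_of_ord x | x <- i],
      order_isomorphic (underlying p) s i
    & [forall c in shading p, cell_empty s i c.1 c.2]].

Definition occ_count (m n : nat) (p : mesh_pattern m) (s : 'S_n) : nat :=
  #|[set i : m.-tuple 'I_n | occurrence p s i]|.

Definition shadingR : {set 'I_4 * 'I_4} :=
  [set c | (nat_of_ord c.1, nat_of_ord c.2) \in
     [:: (1, 0); (1, 1); (2, 0); (2, 1); (2, 2); (3, 0); (3, 1); (3, 2)]%N].

Definition P13 : mesh_pattern 3 := MeshPattern 1%g shadingR.

(* The transposition of the last two points is 132 in one-line notation. *)
Definition P14 : mesh_pattern 3 :=
  MeshPattern (tperm (inord 1) (inord 2)) shadingR.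

Definition var_s : {mpoly int[2]} := 'X_(inord 0).
Definition var_t : {mpoly int[2]} := 'X_(inord 1).

Definition F (n : nat) : {mpoly int[2]} :=
  \sum_(s : 'S_n) var_s ^+ occ_count P13 s * var_t ^+ occ_count P14 s.

(* Main.v *)
Require Import Defs.
From mathcomp Require Import all_boot all_order all_fingroup all_algebra.
From mathcomp.multinomials Require Import mpoly.
From mathcomp Require Import zify ring.

(** In both patterns the shading leaves very little freedom.  Call [i] the
    position of the smallest dot, [x] the position of the middle value and [y]
    the position of the largest one.  The cells say exactly that [s x] is the
    minimum of everything after [i], and that [s y] is the minimum of everything
    after the leftmost of [x] and [y], apart from [s x].  The two patterns differ
    only in which of [x] and [y] comes first ([occurrenceP13],
    [occurrenceP14]), so they are treated together, indexed by a boolean which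
    is [false] for 123 and [true] for 132.

    The counts are computed by removing the first letter.  No shaded cell lies
    in column 0, so an occurrence avoiding the first letter [k] of the word
    [k s] is an occurrence in [s]; an occurrence using it forces [k] to be the
    global minimum, and then consists of a pair in [s], counted by [minpairs],
    one member of which is the minimum of [s] ([occ_insert]).  These pairs obey
    their own rule ([minpairs_insert]): they survive the insertion of a letter
    [k] in front of [s] unless [k] is the new minimum, and a single new pair
    is created, of type 123, when [k] is the smallest letter, and of type 132
    when it is the second smallest.

    Hence, with [x] and [y] now the variables marking the two patterns, the
    generating function [F_n] of the occurrences and the generating function
    [G_n] of occurrences plus pairs (that is, of the occurrences in [0 s]) satisfy
    [F_(n+1) = n F_n + G_n] ([occ_gfS]) and
    [G_(n+2) = (x + y + n) G_(n+1)] ([min_occ_gfS]).  The stated recurrence is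
    then equivalent to [G_(n+1) = (n)! + (x + y - 1) (F_(n+1) - (n)!)], which
    follows by induction.  As [x] and [y] enter only through [x + y], the
    generating function is a polynomial in [x + y], hence symmetric, and
    comparing coefficients gives the equidistribution. *)

Set Implicit Arguments.
Unset Strict Implicit.
Unset Printing Implicit Defensive.

Import GRing.Theory.
Local Open Scope ring_scope.
Local Open Scope nat_scope.

(** * Both patterns as one family *)

(** The [y]-half of an occurrence, common to both patterns: the leftmost of [x]
    and [y] is [y] itself for 132, where [x] then has to be skipped. *)
Definition least_after n (s : 'S_n) (x y : 'I_n) : bool :=
  [forall r : 'I_n, (minn x y < r) ==> (r != x) ==> (s y <= s r)].

(** Occurrences indexed by increasing value, so that [b] only records whether the
    largest value comes before the middle one. *)
Definition occ_at (b : bool) n (s : 'S_n) (i x y : 'I_n) : bool :=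
  [&& i < x, i < y, (y < x) == b, s i < s x, s x < s y,
      [forall r : 'I_n, (i < r) ==> (s x <= s r)] & least_after s x y].

(** The pairs completed to an occurrence by a smaller letter put in front of
    the word. *)
Definition pair_at (b : bool) n (s : 'S_n) (x y : 'I_n) : bool :=
  [&& (y < x) == b, s x == 0 :> nat, s x < s y & least_after s x y].

Definition occ (b : bool) n (s : 'S_n) : nat := \sum_i \sum_x \sum_y occ_at b s i x y.
Definition minpairs (b : bool) n (s : 'S_n) : nat := \sum_x \sum_y pair_at b s x y.

Lemma forall_shadingR (Q : nat -> nat -> bool) :
  [forall c in shadingR, Q (nat_of_ord c.1) (nat_of_ord c.2)] =
  [&& Q 1 0, Q 1 1, Q 2 0, Q 2 1, Q 2 2, Q 3 0, Q 3 1 & Q 3 2].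
Proof.
apply/forall_inP/idP => [H | H [a b]].
  have K a b (ha : a < 4) (hb : b < 4) : (a, b) \in
      [:: (1, 0); (1, 1); (2, 0); (2, 1); (2, 2); (3, 0); (3, 1); (3, 2)] -> Q a b.
    by move=> hab; apply: (H (Ordinal ha, Ordinal hb)); rewrite inE.
  by rewrite !K.
rewrite inE /= !inE !xpair_eqE.
case/and5P: H => ? ? ? ? /and4P[? ? ? ?].
by do 7![case/orP; first by case/andP=> /eqP-> /eqP->]; case/andP=> /eqP-> /eqP->.
Qed.

Lemma forall_ord3 (Q : 'I_3 -> bool) :
  [forall j : 'I_3, Q j] = [&& Q (inord 0), Q (inord 1) & Q (inord 2)].
Proof.
apply/forallP/and3P => [H | [H0 H1 H2] j]; first by split; apply: H.
have -> : j = inord j by rewrite inord_val.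
by case: j => [[|[|[|m]]] hm].
Qed.

Lemma sum_3tuple n (P : pred (3.-tuple 'I_n)) :
  #|[set t | P t]| = \sum_i \sum_j \sum_k P [tuple i; j; k].
Proof.
rewrite cardsE -sum1_card big_mkcond /=.
pose f (p : 'I_n * ('I_n * 'I_n)) : 3.-tuple 'I_n := [tuple p.1; p.2.1; p.2.2].
pose g (t : 3.-tuple 'I_n) := (tnth t (inord 0), (tnth t (inord 1), tnth t (inord 2))).
have fg : cancel g f.
  move=> t; apply: eq_from_tnth => j; have -> : j = inord j by rewrite inord_val.
  by case: j => [[|[|[|m]]] hm] //=; rewrite (tnth_nth (tnth t (inord 0))) /= inordK.
have gf : cancel f g.
  by move=> [i [j k]]; rewrite /g /f /= !(tnth_nth i) /= !inordK.
rewrite (reindex f) /=; last by exists g => ? _; [apply: gf | apply: fg].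
under [RHS]eq_bigr => i _ do rewrite pair_bigA /=.
rewrite pair_bigA /=; apply: eq_bigr => -[i [j k]] _ /=.
by rewrite unfold_in; case: (P _).
Qed.

Lemma val_perm_eq n (s : 'S_n) (i j : 'I_n) :
  (s i == s j :> nat) = (i == j :> nat).
Proof. by rewrite !val_eqE (inj_eq perm_inj). Qed.

(** The shaded cells together: columns 2 and 3 are shaded up to the largest value
    and column 1 up to the middle one, so each column only allows letters above
    its bound.  Stating it for a reordering [i; x; y] of the positions
    [i; j; k] serves both patterns. *)
Lemma shadingE n (s : 'S_n) (i j k x y : 'I_n) :
    perm_eq [:: i; x; y] [:: i; j; k] -> j = minn x y :> nat -> i < j < k ->
    s i < s x < s y ->
  [forall c in shadingR, cell_empty s [tuple i; j; k] c.1 c.2] =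
  [forall r : 'I_n, (i < r) ==> (s x <= s r)] && least_after s x y.
Proof.
move=> pE jmin /andP[ij jk] /andP[six sxy].
have Ev : occ_values s [tuple i; j; k] =
    [:: 0; (s i).+1; (s x).+1; (s y).+1; n.+1].
  rewrite /occ_values (_ : sort _ _ = [:: (s i).+1; (s x).+1; (s y).+1]) //.
  apply: (sorted_eq leq_trans anti_leq (sort_sorted leq_total _)).
    by rewrite /= ?ltnS (ltnW six) (ltnW sxy).
  rewrite perm_sort perm_sym.
  exact: (perm_map (fun z => (nat_of_ord (s z)).+1) pE).
have vr r : (r \in [:: i; j; k]) =
    (nat_of_ord (s r) \in [:: nat_of_ord (s i); nat_of_ord (s x); nat_of_ord (s y)]).
  by rewrite -(perm_mem pE) !inE !val_perm_eq.
(* The cells speak of letters other than the dots, the target of all letters. *)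
transitivity [forall r : 'I_n, (r \notin [:: i; j; k]) ==> (i < r) ==>
     (if r < j then s x < s r else s y < s r)]; last first.
  have C r : (r \notin [:: i; j; k]) ==> (i < r) ==>
        (if r < j then s x < s r else s y < s r) =
      ((i < r) ==> (s x <= s r)) && ((j < r) ==> (r != x) ==> (s y <= s r)).
    rewrite -(perm_mem pE).
    case: (boolP (r \in _)); rewrite !inE.
      case/or3P => /eqP->; rewrite ?eqxx ?leqnn ?implybT ?(ltnW sxy) ?andbT //=;
        clear vr pE Ev; lia.
    rewrite !negb_or => /and3P[_ rx ry]; rewrite rx.
    have : r != x :> nat /\ r != y :> nat by [].
    have : s r != s x :> nat /\ s r != s y :> nat by rewrite !val_perm_eq.
    clear vr pE Ev; case: (ltnP r j); lia.
  rewrite /least_after -jmin.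
  apply/forallP/andP => [H|[/forallP HA /forallP HB] r].
    by split; apply/forallP => r; have := H r; rewrite C => /andP[].
  by rewrite C HA HB.
rewrite (forall_shadingR (fun a b => cell_empty s [tuple i; j; k] a b)).
rewrite /cell_empty Ev /=.
apply/idP/forallP => [|H].
  case/and5P => /forallP H10 /forallP H11 /forallP H20 /forallP H21.
  case/and4P => /forallP H22 /forallP H30 /forallP H31 /forallP H32 r.
  have := ltn_ord r; move: (vr r); rewrite !inE -!val_eqE /=.
  case: (ltnP r j) => [rj|jr].
    move: (H10 r) (H11 r) => {H10 H11 H20 H21 H22 H30 H31 H32}; lia.
  case: (ltnP r k) => [rk|kr].
    move: (H20 r) (H21 r) (H22 r) => {H10 H11 H20 H21 H22 H30 H31 H32}; lia.
  move: (H30 r) (H31 r) (H32 r) => {H10 H11 H20 H21 H22 H30 H31 H32}; lia.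
apply/and5P; split; last apply/and4P; try split.
all: apply/forallP => r; move: (vr r) (H r); rewrite !inE -!val_eqE /=.
all: have := ltn_ord r; case: ifP; lia.
Qed.

Lemma occurrenceP13 n (s : 'S_n) (i x y : 'I_n) :
  occurrence P13 s [tuple i; x; y] = occ_at false s i x y.
Proof.
rewrite /occurrence /= /order_isomorphic !forall_ord3 !perm1 !(tnth_nth i) !inordK //=.
rewrite /occ_at.
case ix: (i < x) => //=.
case xy: (x < y); last first.
  by case: ltngtP xy => //= [|/val_inj->]; rewrite ?ltnn ?andbF.
case sx: (s i < s x); last by rewrite !andbF.
case sy: (s x < s y); last by rewrite !andbF.
rewrite (@shadingE _ s i x y x y) ?perm_refl //= ?ix ?xy ?sx ?sy
  ?(minn_idPl (ltnW xy)) //.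
rewrite !ltnn (ltn_trans ix xy) (ltn_trans sx sy) ![_ < s i]ltnNge.
by rewrite ?(ltnW sx) ?(ltnW (ltn_trans sx sy)) [s y < _]ltnNge
  (ltnW sy) (ltnNge y x) (ltnW xy).
Qed.

Lemma P14_values (j : 'I_3) : tperm (inord 1) (inord 2) j = nth 0 [:: 0; 2; 1] j :> nat.
Proof.
have -> : j = inord j by rewrite inord_val.
case: j => [[|[|[|m]]] hm] //=; rewrite permE /= -!val_eqE /= !inordK //=.
Qed.

Lemma occurrenceP14 n (s : 'S_n) (i x y : 'I_n) :
  occurrence P14 s [tuple i; y; x] = occ_at true s i x y.
Proof.
rewrite /occurrence /= /order_isomorphic !forall_ord3 !P14_values
  !(tnth_nth i) !inordK //=.
rewrite /occ_at.
case iy: (i < y) => /=; last by rewrite andbF.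
case yx: (y < x); last by rewrite /= andbF.
rewrite (ltn_trans iy yx) /=.
case sx: (s i < s x); last by rewrite !andbF.
case sy: (s x < s y); last by rewrite !andbF.
rewrite (@shadingE _ s i y x x y) //= ?iy ?yx ?sx ?sy
  ?(minn_idPr (ltnW yx)) //; last first.
  by rewrite perm_cons (perm_catC [:: x] [:: y]).
rewrite !ltnn (ltn_trans sx sy) ![_ < s i]ltnNge.
by rewrite ?(ltnW sx) ?(ltnW (ltn_trans sx sy)) [s y < _]ltnNge (ltnW sy).
Qed.

Lemma occ_countE (b : bool) n (s : 'S_n) :
  occ_count (if b then P14 else P13) s = occ b s.
Proof.
rewrite /occ_count; case: b; rewrite sum_3tuple /occ; apply: eq_bigr => i _.
  rewrite exchange_big; apply: eq_bigr => x _; apply: eq_bigr => y _.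
  by rewrite occurrenceP14.
by apply: eq_bigr => x _; apply: eq_bigr => y _; rewrite occurrenceP13.
Qed.

(** * Removing the first letter *)

(** The word [k s], the letters of [s] being renumbered to avoid [k]. *)
Notation insert k s := (lift_perm ord0 k s).

Lemma forall_ordS n (P : pred 'I_n.+1) :
  [forall r, P r] = P ord0 && [forall r, P (lift ord0 r)].
Proof.
apply/forallP/andP => [H|[P0 /forallP H] r]; first by split=> //; apply/forallP.
by case: (unliftP ord0 r) => [r' ->|->].
Qed.

Lemma insert_lt n (k : 'I_n.+1) (s : 'S_n) (x y : 'I_n) :
  (insert k s (lift ord0 x) < insert k s (lift ord0 y)) = (s x < s y).
Proof. by rewrite !lift_perm_lift !ltnNge leq_bump2. Qed.

Lemma insert_le n (k : 'I_n.+1) (s : 'S_n) (x y : 'I_n) :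
  (insert k s (lift ord0 x) <= insert k s (lift ord0 y)) = (s x <= s y).
Proof. by rewrite !lift_perm_lift leq_bump2. Qed.

Lemma lift0_lt n (x y : 'I_n) : (lift ord0 x < lift ord0 y) = (x < y).
Proof. by []. Qed.

Lemma least_after_insert n (k : 'I_n.+1) (s : 'S_n) (x y : 'I_n) :
  least_after (insert k s) (lift ord0 x) (lift ord0 y) = least_after s x y.
Proof.
rewrite /least_after forall_ordS ltn0 /=; apply: eq_forallb => r.
by rewrite insert_le (inj_eq lift_inj) /= /bump /= !add1n minnSS.
Qed.

Lemma perm_eq0_min n (s : 'S_n) (x : 'I_n) :
  (s x == 0 :> nat) = [forall r, s x <= s r].
Proof.
apply/eqP/forallP => [-> //|H].
have n_gt0 : 0 < n by apply: leq_ltn_trans (ltn_ord x).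
have := H (s^-1 (Ordinal n_gt0))%g; rewrite permKV leqn0; exact: eqP.
Qed.

Lemma occ_at_insert n (b : bool) (k : 'I_n.+1) (s : 'S_n) (i x y : 'I_n) :
  occ_at b (insert k s) (lift ord0 i) (lift ord0 x) (lift ord0 y) = occ_at b s i x y.
Proof.
rewrite /occ_at !lift0_lt !insert_lt least_after_insert forall_ordS /=.
by under eq_forallb => r do rewrite lift0_lt insert_le.
Qed.

(** The first letter can only be the smallest dot of an occurrence, all other
    letters being larger than it: so it is 0, and the middle dot is the minimum
    of the rest. *)
Lemma occ_at_insert0 n (b : bool) (k : 'I_n.+1) (s : 'S_n) (x y : 'I_n) :
  occ_at b (insert k s) ord0 (lift ord0 x) (lift ord0 y) =
  (k == ord0) && pair_at b s x y.
Proof.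
rewrite /occ_at /pair_at lift0_lt insert_lt least_after_insert forall_ordS /=.
under eq_forallb => r do rewrite insert_le.
rewrite -perm_eq0_min lift_perm_id lift_perm_lift /= -val_eqE /=.
have [-> /=|sx] := eqVneq (s x : nat) 0; last by rewrite !andbF.
by rewrite /bump; case: (nat_of_ord k) => [|k'] //=; rewrite andbF.
Qed.

Lemma occ_insert n (b : bool) (k : 'I_n.+1) (s : 'S_n) :
  occ b (insert k s) = occ b s + (k == ord0) * minpairs b s.
Proof.
rewrite /occ big_ord_recl addnC; congr (_ + _).
  apply: eq_bigr => i _.
  rewrite big_ord_recl big1 ?add0n => [|y _]; last by rewrite /occ_at ltn0.
  apply: eq_bigr => x _.
  rewrite big_ord_recl {1}/occ_at ltn0 andbF add0n.
  by apply: eq_bigr => y _; rewrite occ_at_insert.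
rewrite big_ord_recl big1 ?add0n => [|y _]; last by rewrite /occ_at ltnn.
rewrite /minpairs big_distrr; apply: eq_bigr => x _ /=.
rewrite big_ord_recl {1}/occ_at ltnn andbF add0n big_distrr.
by apply: eq_bigr => y _; rewrite occ_at_insert0 -mulnb.
Qed.

Lemma sum_perm_eq0 n (s : 'S_n.+1) : \sum_x (s x == 0 :> nat) = 1.
Proof.
rewrite (reindex_inj (@perm_inj _ s^-1%g)) big_ord_recl permKV big1 // => i _.
by rewrite permKV.
Qed.

(** The minimum of [s] stays the minimum exactly when [k] is not below it. *)
Lemma pair_at_insert n (b : bool) (k : 'I_n.+1) (s : 'S_n) (x y : 'I_n) :
  pair_at b (insert k s) (lift ord0 x) (lift ord0 y) = (k != ord0) && pair_at b s x y.
Proof.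
rewrite /pair_at lift0_lt insert_lt least_after_insert lift_perm_lift -val_eqE /=.
rewrite /bump; case: (nat_of_ord k) => [|k']; case: (nat_of_ord (s x)) => [|m].
all: by rewrite /= ?andbF // addn_eq0 !andbF.
Qed.

Lemma pair_at_low0 n (b : bool) (k : 'I_n.+1) (s : 'S_n) (y : 'I_n) :
  pair_at b (insert k s) ord0 (lift ord0 y) =
  [&& ~~ b, k == ord0 & s y == 0 :> nat].
Proof.
rewrite /pair_at ltn0 lift_perm_id lift_perm_lift perm_eq0_min
  /least_after forall_ordS min0n ltnn /=.
under eq_forallb => r do rewrite insert_le /=.
rewrite -val_eqE /=; case: b => //=.
by case: eqP => //= ->.
Qed.

(** As the high member of a pair of type 132, the first letter has exactly one
    letter below it, hence is the second smallest. *)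
Lemma pair_at_high0 n (b : bool) (k : 'I_n.+2) (s : 'S_n.+1) (x : 'I_n.+1) :
  pair_at b (insert k s) (lift ord0 x) ord0 =
  [&& b, k == 1 :> nat & s x == 0 :> nat].
Proof.
rewrite /pair_at /least_after lift_perm_id lift_perm_lift forall_ordS minn0 ltnn /=.
case: b => //=.
under eq_forallb => r do rewrite lift_perm_lift (inj_eq lift_inj) /=.
apply/and3P/andP => [[sx0 sxk /forallP H]|[/eqP k1 /eqP sx0]].
  have sx : s x = 0 :> nat by move: sx0; rewrite addn_eq0 => /andP[_ /eqP].
  rewrite sx; split=> //; rewrite eqn_leq (leq_ltn_trans _ sxk) // andbT leqNgt.
  (* If k were at least 2, the letter 1 of s would lie below it. *)
  apply/negP => k2.
  have n1 : 1 < n.+1 by have := ltn_ord k; lia.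
  have := H (s^-1 (Ordinal n1))%g; rewrite permKV /= -(inj_eq (@perm_inj _ s)) permKV.
  rewrite -val_eqE /= sx /= /bump; lia.
rewrite sx0 k1; split=> //; apply/forallP => r; apply/implyP => rx.
have : s r != s x :> nat by rewrite val_perm_eq.
by rewrite sx0 /bump; case: (nat_of_ord (s r)).
Qed.

(** A new pair joins the first letter [k] with the minimum of [s], and occurs for
    [k = 0] in type 123 and for [k = 1] in type 132: this is the number [b].
    A nonempty [s] is needed to provide the second member. *)
Lemma minpairs_insert n (b : bool) (k : 'I_n.+2) (s : 'S_n.+1) :
  minpairs b (insert k s) = (k != ord0) * minpairs b s + (k == b :> nat).
Proof.
have row x : \sum_y pair_at b (insert k s) (lift ord0 x) y =
    (b && (k == 1 :> nat)) * (s x == 0 :> nat)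
    + (k != ord0) * \sum_y pair_at b s x y.
  rewrite big_ord_recl pair_at_high0 andbA -mulnb big_distrr; congr (_ + _).
  by apply: eq_bigr => y _; rewrite pair_at_insert -mulnb.
have row0 : \sum_y pair_at b (insert k s) ord0 y = ~~ b && (k == ord0).
  rewrite big_ord_recl {1}/pair_at !ltnn !andbF add0n.
  under eq_bigr => y _ do rewrite pair_at_low0 andbA -mulnb.
  by rewrite -big_distrr /= sum_perm_eq0 muln1.
rewrite /minpairs big_ord_recl row0 (eq_bigr _ (fun x _ => row x)).
rewrite big_split /= -!big_distrr /= sum_perm_eq0 muln1 addnA addnC.
by congr (_ + _); case: b {row row0}; rewrite /= ?addn0.
Qed.

Lemma sum_insert (V : nmodType) n (f : 'S_n.+1 -> V) :
  (\sum_s f s = \sum_(k < n.+1) \sum_(s : 'S_n) f (insert k s))%R.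
Proof.
rewrite pair_bigA (reindex (fun p : 'I_n.+1 * 'S_n => insert p.1 p.2)) //=.
apply: onW_bij; apply: inj_card_bij => [[k s] [l t] /= E|].
  have kl : k = l by rewrite -(lift_perm_id ord0 k s) E lift_perm_id.
  congr (_, _) => //; apply/permP => i; apply: (@lift_inj _ k).
  by rewrite -(lift_perm_lift ord0) E kl lift_perm_lift.
by rewrite card_prod card_ord !card_Sn factS.
Qed.

(** * Generating functions *)

Local Open Scope ring_scope.

Section GeneratingFunctions.

Variables (R : comNzRingType) (x y : R).

Definition occ_gf n : R := \sum_(s : 'S_n) x ^+ occ false s * y ^+ occ true s.

(** The generating function of the occurrences in [0 s]. *)
Definition min_occ_gf n : R :=
  \sum_(s : 'S_n) x ^+ (occ false s + minpairs false s)
                  * y ^+ (occ true s + minpairs true s).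

(** Only the smallest first letter creates occurrences; the [n] others leave them
    unchanged. *)
Lemma occ_gfS n : occ_gf n.+1 = n%:R * occ_gf n + min_occ_gf n.
Proof.
rewrite /occ_gf sum_insert big_ord_recl addrC; congr (_ + _).
  rewrite -[n in n%:R]card_ord -sumr_const mulr_suml; apply: eq_bigr => k _.
  by rewrite mul1r; apply: eq_bigr => s _; rewrite !occ_insert !addn0.
by apply: eq_bigr => s _; rewrite !occ_insert !mul1n.
Qed.

(** In [0 k s] the letters [k = 0] and [k = 1] each add one occurrence, of type
    123 and 132 respectively; the [n] others add none. *)
Lemma min_occ_gfS n : min_occ_gf n.+2 = (x + y + n%:R) * min_occ_gf n.+1.
Proof.
have insertE b (k : 'I_n.+2) (s : 'S_n.+1) :
    (occ b (insert k s) + minpairs b (insert k s)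
     = occ b s + minpairs b s + (k == b :> nat))%N.
  rewrite occ_insert minpairs_insert.
  by case: (k == ord0); rewrite /= ?mul0n ?mul1n ?addn0 ?addnA.
rewrite /min_occ_gf sum_insert !big_ord_recl /= addrA !mulrDl; congr (_ + _ + _).
- rewrite mulr_sumr; apply: eq_bigr => s _; rewrite !insertE addn0 addn1 exprS; ring.
- rewrite mulr_sumr; apply: eq_bigr => s _; rewrite !insertE addn0 addn1 !exprS; ring.
rewrite -[n in n%:R]card_ord -sumr_const mulr_suml; apply: eq_bigr => k _.
by rewrite mul1r; apply: eq_bigr => s _; rewrite !insertE !addn0.
Qed.

Lemma occ_gf0 : occ_gf 0 = 1.
Proof.
rewrite /occ_gf (eq_bigr (fun=> 1)) => [|s _]; last by rewrite /occ !big_ord0 mulr1.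
by rewrite sumr_const card_Sn.
Qed.

Lemma min_occ_gf0 : min_occ_gf 0 = 1.
Proof.
rewrite /min_occ_gf (eq_bigr (fun=> 1)) => [|s _].
  by rewrite sumr_const card_Sn.
by rewrite /occ /minpairs !big_ord0 mulr1.
Qed.

Lemma min_occ_gf1 : min_occ_gf 1 = 1.
Proof.
rewrite /min_occ_gf (eq_bigr (fun=> 1)) => [|s _].
  by rewrite sumr_const card_Sn.
by rewrite /occ /minpairs !big_ord1 /occ_at /pair_at !ltnn !andbF mulr1.
Qed.

Lemma occ_gf_rec n :
  occ_gf n.+3 = (n.+3 * n.+1`!)%:R
                + (n.+1%:R + x + y) * (occ_gf n.+2 - n.+1`!%:R).
Proof.
(* This expresses the increment in occ_gfS through the series itself. *)
have key : min_occ_gf n.+2 = n.+1`!%:R + (x + y - 1) * (occ_gf n.+2 - n.+1`!%:R).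
  elim: n => [|n IHn].
    by rewrite min_occ_gfS !occ_gfS occ_gf0
      min_occ_gf0 min_occ_gf1 (_ : 1`! = 1%N) //; ring.
  rewrite min_occ_gfS IHn (occ_gfS n.+2) IHn (factS n.+1) !natrM; ring.
rewrite occ_gfS key natrM; ring.
Qed.

End GeneratingFunctions.

Lemma min_occ_gf_poly n : exists g : {poly int},
  forall (R : comNzRingType) (x y : R), min_occ_gf x y n = (map_poly intr g).[x + y].
Proof.
have one_poly (R : comNzRingType) (z : R) : 1 = (map_poly intr (1 : {poly int})).[z].
  by rewrite rmorph1 hornerC.
case: n => [|n]; first by exists 1 => R x y; rewrite min_occ_gf0 -one_poly.
elim: n => [|n [g gE]]; first by exists 1 => R x y; rewrite min_occ_gf1 -one_poly.
exists (('X + n%:R) * g) => R x y.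
rewrite min_occ_gfS gE rmorphM hornerM rmorphD /= map_polyX rmorph_nat hornerD hornerX.
by rewrite -polyC_natr hornerC.
Qed.

Lemma occ_gf_poly n : exists g : {poly int},
  forall (R : comNzRingType) (x y : R), occ_gf x y n = (map_poly intr g).[x + y].
Proof.
elim: n => [|n [g gE]].
  by exists 1 => R x y; rewrite occ_gf0 rmorph1 hornerC.
have [h hE] := min_occ_gf_poly n.
exists (n%:R * g + h) => R x y.
by rewrite occ_gfS gE hE rmorphD rmorphM /= rmorph_nat
  hornerD hornerM -polyC_natr hornerC.
Qed.

Lemma occ_gfC (R : comNzRingType) (x y : R) n : occ_gf x y n = occ_gf y x n.
Proof. by have [g gE] := occ_gf_poly n; rewrite !gE addrC. Qed.

(** * The distribution in two variables *)

Lemma F_occ_gf n : F n = occ_gf var_s var_t n.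
Proof.
by apply: eq_bigr => s _; rewrite -(occ_countE false) -(occ_countE true).
Qed.

Lemma map_polyC_intr (g : {poly int}) :
  map_poly (@mpolyC 2 int) g = map_poly intr g.
Proof. by apply: eq_map_poly => c; rewrite /= -[in LHS](intz c) rmorph_int. Qed.

(** The joint distribution is read off as coefficients of a bivariate polynomial,
    encoded as a polynomial in ['X] with coefficients in the variable inside
    ['X%:P]. *)
Lemma card_occE n (k l : nat) b :
  #|[set s : 'S_n | (occ b s == k) && (occ (~~ b) s == l)]|%:R
  = ((\sum_(s : 'S_n) 'X ^+ occ b s * ('X%:P : {poly {poly int}}) ^+ occ (~~ b) s)`_k)`_l.
Proof.
rewrite cardsE -sum1_card natr_sum coef_sum coef_sum big_mkcond /=.
apply: eq_bigr => s _; rewrite -rmorphXn /= coefMC !coefXn unfold_in.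
by rewrite [k == _]eq_sym; case: eqP => _;
  rewrite ?mul0r ?coef0 // mul1r coefXn eq_sym; case: eqP.
Qed.

Lemma card_occC n (k l : nat) :
  #|[set s : 'S_n | (occ false s == k) && (occ true s == l)]|
  = #|[set s : 'S_n | (occ true s == k) && (occ false s == l)]|.
Proof.
apply/eqP; rewrite -(Num.Theory.eqr_nat int) (card_occE _ _ _ false)
  (card_occE _ _ _ true); apply/eqP.
congr (nth 0 (polyseq (nth 0 (polyseq _) k)) l).
rewrite -/(occ_gf _ _ _) occ_gfC.
by apply: eq_bigr => s _; rewrite mulrC.
Qed.

Theorem theorem2p15 :
  [/\ F 1 = 1,
      F 2 = 2%:R,
      (forall n : nat, (3 <= n)%N ->
         F n = (n * (n - 2)`!)%N%:R
               + ((n - 2)%N%:R + var_s + var_t) * (F (n - 1) - ((n - 2)`!)%:R)),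
      (forall n : nat, (1 <= n)%N ->
         exists g : {poly int}, F n = (map_poly (@mpolyC 2 int) g).[var_s + var_t])
    & (forall n : nat, (1 <= n)%N -> forall k l : nat,
         #|[set s : 'S_n | (occ_count P13 s == k) && (occ_count P14 s == l)]|
         = #|[set s : 'S_n | (occ_count P14 s == k) && (occ_count P13 s == l)]|)].
Proof.
split.
- by rewrite F_occ_gf occ_gfS min_occ_gf0 mul0r add0r.
- rewrite F_occ_gf !occ_gfS occ_gf0 min_occ_gf0 min_occ_gf1; ring.
- case=> [|[|[|n]]] // _; rewrite subn2 subn1 /= !F_occ_gf; exact: occ_gf_rec.
- move=> n _; have [g gE] := occ_gf_poly n.
  by exists g; rewrite F_occ_gf gE map_polyC_intr.
move=> n _ k l; have := card_occC n k l.
have E (s : 'S_n) : (occ_count P13 s = occ false s) * (occ_count P14 s = occ true s).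
  by rewrite -(occ_countE false) -(occ_countE true).
have -> : [set s : 'S_n | (occ false s == k) && (occ true s == l)] =
    [set s : 'S_n | (occ_count P13 s == k) && (occ_count P14 s == l)].
  by apply/setP => s; rewrite !inE !E.
move=> ->; congr #|pred_of_set _|; apply/setP => s; by rewrite !inE !E.
Qed.
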